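(* Let $E$ be a Banach space with $E\neq\{0\}$. There exists a set function $\nu\colon \mathcal B_E\to[0,+\infty)$ which satisfies axioms (A1), (A3), (A4) and (A5), but does not satisfy axiom (A2).
   Context: $E$ is a real or complex Banach space; $\mathcal B_E$ denotes the family of all non-empty bounded subsets of $E$, and $\mathcal K_E\subseteq\mathcal B_E$ the subfamily of relatively compact sets. $\operatorname{conv}A$ is the (not necessarily closed) convex hull; $A+B=\{a+b: a\in A, b\in B\}$, $\lambda A=\{\lambda a: a\in A\}$. For $\nu\colon\mathcal B_E\to[0,+\infty)$ put $\ker\nu=\{A\in\mathcal B_E:\nu(A)=0\}$. The axioms are: (A1) $\ker\nu$ is non-empty and $\ker\nu\subseteq\mathcal K_E$; (A2) for all $A,B\in\mathcal B_E$, if $A\subseteq B$ then $\nu(A)\le\nu(B)$; (A3) $\nu(\operatorname{conv}A)=\nu(A)$ for all $A\in\mathcal B_E$; (A4) $\nu(\lambda A+(1-\lambda)B)\le\lambda\nu(A)+(1-\lambda)\nu(B)$ for all $A,B\in\mathcal B_E$ and all $\lambda\in[0,1]$; (A5) if $A_n\in\mathcal B_E$ ($n\in\mathbb N$) are closed, $A_{n+1}\subseteq A_n$ for all $n$, and $\nu(A_n)\to0$, then $\bigcap_{n=1}^\infty A_n\ne\emptyset$. *)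

(* Defs.v *)
From HB Require Import structures.
From mathcomp Require Import all_boot all_order all_algebra.
From mathcomp Require Import all_classical all_reals all_analysis.
From mathcomp Require Import complex.

Set Implicit Arguments.
Unset Strict Implicit.
Unset Printing Implicit Defensive.

Import Order.TTheory GRing.Theory Num.Theory.
Import numFieldNormedType.Exports.

Local Open Scope classical_set_scope.
Local Open Scope ring_scope.

(* K is the scalar field, R or R[i], and inK the inclusion of the reals into
   K.  A set function on the non-empty bounded sets is a total function
   nu : set E -> R of which only the values on Bfam are ever used. *)
Section MeasureOfNoncompactness.
Context {R : realType} {K : numFieldType} (inK : R -> K).
Context {E : completeNormedModType K}.

Definition Bfam : set (set E) := [set A | A !=set0 /\ bounded_set A].

Definition Kfam : set (set E) := [set A | Bfam A /\ compact (closure A)].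

(* The weights in convex_set range over the t : K with 0 <= t <= 1; for
   K = R[i] the order forces such t to be real. *)
Definition convex_hull (A : set E) : set E := smallest (@convex_set K E) A.

Definition msum (A B : set E) : set E := [set a + b | a in A & b in B].

Definition mscale (l : R) (A : set E) : set E := [set inK l *: a | a in A].

Definition nonneg_on_Bfam (nu : set E -> R) : Prop :=
  forall A, Bfam A -> 0 <= nu A.

Definition kernel (nu : set E -> R) : set (set E) :=
  [set A | Bfam A /\ nu A = 0].

Definition axiomA1 (nu : set E -> R) : Prop :=
  kernel nu !=set0 /\ kernel nu `<=` Kfam.

Definition axiomA2 (nu : set E -> R) : Prop :=
  forall A B, Bfam A -> Bfam B -> A `<=` B -> nu A <= nu B.

Definition axiomA3 (nu : set E -> R) : Prop :=
  forall A, Bfam A -> nu (convex_hull A) = nu A.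

Definition axiomA4 (nu : set E -> R) : Prop :=
  forall A B (l : R), Bfam A -> Bfam B -> 0 <= l <= 1 ->
    nu (msum (mscale l A) (mscale (1 - l) B)) <= l * nu A + (1 - l) * nu B.

Definition axiomA5 (nu : set E -> R) : Prop :=
  forall A : nat -> set E,
    (forall n, Bfam (A n) /\ closed (A n)) ->
    (forall n, A n.+1 `<=` A n) ->
    nu (A n) @[n --> \oo] --> (0 : R) ->
    \bigcap_n A n !=set0.

End MeasureOfNoncompactness.

(* Main.v *)
Require Import Defs.
From HB Require Import structures.
From mathcomp Require Import all_boot all_order all_algebra.
From mathcomp Require Import all_classical all_reals all_analysis.
From mathcomp Require Import complex.

Set Implicit Arguments.
Unset Strict Implicit.
Unset Printing Implicit Defensive.

Import Order.TTheory GRing.Theory Num.Theory.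
Import numFieldNormedType.Exports.

Local Open Scope classical_set_scope.
Local Open Scope ring_scope.

(** The witness is nu(A) = diam A + 2 d(A), where d(A) is the distance from
    the origin to the convex hull of A.

    The diameter does the work of a measure of noncompactness: a set with
    nu(A) = 0 is a single point, and along a decreasing sequence of closed sets
    with nu(A_n) -> 0 the diameters tend to 0, so Cantor's intersection theorem
    applies in the complete space E (nu_A1, nu_A5).  Both summands depend on A
    only through its convex hull (diam_hull, hull_hull), and both are convex
    for Minkowski combinations (diam_combination, origin_dist_combination); the
    second of these holds because a convex combination of a point of conv A and
    a point of conv B lies in conv (t A + (1 - t) B) (hull_combination).

    The term d(A) decreases as A grows, and the factor 2 lets it win over the
    diameter: for x <> 0, nu {x} = 2 |x|, while adjoining the origin gives
    nu {0, x} = |x| (nu_notA2).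

    Real and complex scalars are treated together.  The norm of E takes its
    values in the scalar field K, whereas nu is real-valued, so norms are
    carried to R by a map re : K -> R that inverts the inclusion inK on the
    nonnegative scalars. *)

Section NonMonotoneMeasure.
Context {R : realType} {K : numFieldType} (inK : {rmorphism R -> K}).
Context (re : K -> R).
Context (ler_inK : forall x y : R, (inK x <= inK y) = (x <= y)).
Context (reK : forall k : K, 0 <= k -> inK (re k) = k).
Context {E : completeNormedModType K}.
Implicit Types (A B C : set E) (x y : E) (t d : R).

(** * The real-valued norm and convex combinations *)

Definition rnorm (x : E) : R := re `|x|.

Lemma inK_rnorm x : inK (rnorm x) = `|x|.
Proof. exact: reK. Qed.

Lemma rnorm_ge0 x : 0 <= rnorm x.
Proof. by rewrite -ler_inK rmorph0 inK_rnorm. Qed.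

Lemma rnorm_eq0 x : rnorm x = 0 -> x = 0.
Proof. by move=> x0; apply/normr0_eq0; rewrite -inK_rnorm x0 rmorph0. Qed.

Lemma rnorm0 : rnorm 0 = 0.
Proof.
by apply/le_anti; rewrite rnorm_ge0 -ler_inK inK_rnorm normr0 rmorph0 lexx.
Qed.

Lemma ler_rnormD x y : rnorm (x + y) <= rnorm x + rnorm y.
Proof. by rewrite -ler_inK rmorphD !inK_rnorm ler_normD. Qed.

Lemma rnormB x y : rnorm (x - y) = rnorm (y - x).
Proof. by rewrite /rnorm distrC. Qed.

Lemma rnormZ t x : 0 <= t -> rnorm (inK t *: x) = t * rnorm x.
Proof.
move=> t0; apply/le_anti; rewrite -!ler_inK rmorphM !inK_rnorm normrZ.
by rewrite ger0_norm ?lexx// -(rmorph0 inK) ler_inK.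
Qed.

Definition mix (t : R) (x y : E) : E := inK t *: x + inK (1 - t) *: y.

Lemma mixB t x y x' y' : mix t x y - mix t x' y' = mix t (x - x') (y - y').
Proof. by rewrite /mix !scalerBr addrACA opprD. Qed.

Lemma mixxx t x : mix t x x = x.
Proof. by rewrite /mix -scalerDl -rmorphD addrC subrK rmorph1 scale1r. Qed.

(** The interchange law makes the set of x with mix t x y in C convex for each
    convex C, y being written as mix s y y; see hull_combination. *)
Lemma mix_mix s t x y z w :
  mix s (mix t x y) (mix t z w) = mix t (mix s x z) (mix s y w).
Proof.
rewrite /mix !scalerDr !scalerA -!rmorphM.
by rewrite addrACA ![inK (t * _)]rmorphM ![inK ((1 - t) * _)]rmorphM
  -!rmorphM ![s * _]mulrC ![(1 - s) * _]mulrC.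
Qed.

Lemma rnorm_mix t x y : 0 <= t <= 1 ->
  rnorm (mix t x y) <= t * rnorm x + (1 - t) * rnorm y.
Proof.
move=> /andP[t0 t1]; apply: le_trans (ler_rnormD _ _) _.
by rewrite !rnormZ ?subr_ge0.
Qed.

(** Every weight of K in [0, 1] is real, so convexity over K is convexity with
    real weights. *)
Lemma convex_setP C : @convex_set K E C <->
  (forall t x y, 0 <= t <= 1 -> C x -> C y -> C (mix t x y)).
Proof.
split=> [cC t x y /andP[t0 t1] Cx Cy|cC x y l].
  have k01 : (0 <= inK t) && (inK t <= 1).
    by rewrite -(rmorph0 inK) -(rmorph1 inK) !ler_inK t0 t1.
  have := cC x y (Itv01 (andP k01).1 (andP k01).2).
  rewrite !inE => /(_ Cx Cy).
  by rewrite /mix rmorphB rmorph1.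
rewrite !inE => Cx Cy.
have l0 : 0 <= l%:num by [].
have l1 : l%:num <= 1 by [].
have := cC (re l%:num) x y.
rewrite /mix rmorphB (rmorph1 inK) reK //; apply => //.
by rewrite -!ler_inK reK // rmorph0 (rmorph1 inK) l0 l1.
Qed.

(** * Convex hulls and Minkowski combinations *)

Notation hull := (@convex_hull K E).

Lemma hull_convex A : @convex_set K E (hull A).
Proof.
apply/convex_setP => t x y t01 hx hy C [cC AC].
by move/convex_setP: (cC); apply => //; [exact: hx|exact: hy].
Qed.

Lemma sub_hull A : A `<=` hull A.
Proof. exact: sub_gen_smallest. Qed.

Lemma hull_sub A C : @convex_set K E C -> A `<=` C -> hull A `<=` C.
Proof. exact: smallest_sub. Qed.

Lemma hull_hull A : hull (hull A) = hull A.
Proof. exact/smallest_id/hull_convex. Qed.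

Definition combination t A B : set E :=
  Defs.msum (Defs.mscale inK t A) (Defs.mscale inK (1 - t) B).

Lemma combinationP t A B z :
  combination t A B z <-> exists x y, [/\ A x, B y & z = mix t x y].
Proof.
split=> [[_ [x Ax <-] [_ [y By <-] <-]]|[x [y [Ax By ->]]]].
  by exists x, y.
by exists (inK t *: x); [exists x|exists (inK (1 - t) *: y) => //; exists y].
Qed.

(** The points y for which mix t a y belongs to the right-hand hull form a
    convex set, so an inclusion known for y in B extends to y in hull B; the
    same argument in the first variable then passes from A to hull A. *)
Lemma hull_combination t A B x y :
  hull A x -> hull B y -> hull (combination t A B) (mix t x y).
Proof.
pose C := hull (combination t A B).
have /convex_setP cC : @convex_set K E C by exact: hull_convex.
have AhB a b : A a -> hull B b -> C (mix t a b).
  move=> Aa; move: b; apply: hull_sub => [|b Bb]; last first.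
    by apply: sub_hull; apply/combinationP; exists a, b.
  apply/convex_setP => s b b' s01 Cb Cb' /=.
  by rewrite -[X in mix t X _](mixxx s a) mix_mix; exact: cC.
move=> hAx hBy; move: x hAx; apply: hull_sub => [|a Aa]; last exact: AhB.
apply/convex_setP => s a a' s01 Ca Ca' /=.
by rewrite -[X in mix t _ X](mixxx s y) mix_mix; exact: cC.
Qed.

(** * Diameter *)

Definition diam_le A d := forall x y, A x -> A y -> rnorm (x - y) <= d.

Lemma bounded_diam_le A : bounded_set A -> exists d, diam_le A d.
Proof.
move=> /pinfty_ex_gt0[M M0 AM]; exists (re M + re M) => x y Ax Ay.
by rewrite -ler_inK rmorphD inK_rnorm (reK (ltW M0))
  (le_trans (ler_normB _ _))// lerD//; exact: AM.
Qed.

(** Balls are convex, so a ball centred at a point of A that contains A also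
    contains hull A; then a ball centred at a point of hull A that contains A
    contains hull A as well. *)
Lemma diam_le_hull A d : diam_le A d -> diam_le (hull A) d.
Proof.
have ball_convex z : @convex_set K E [set x | rnorm (x - z) <= d].
  apply/convex_setP => t x y t01 /= xd yd.
  rewrite -[X in _ - X](mixxx t z) mixB (le_trans (rnorm_mix _ _ t01))//.
  move: t01 => /andP[t0 t1].
  have -> : d = t * d + (1 - t) * d by rewrite -mulrDl addrC subrK mul1r.
  by rewrite lerD// ler_wpM2l// subr_ge0.
move=> Ad x y hx hy; move: x hx.
apply: hull_sub => [|x Ax]; first exact: ball_convex.
rewrite /= rnormB; move: y hy.
apply: hull_sub => [|y Ay]; first exact: ball_convex.
exact: Ad.
Qed.

Definition diam A : R := sup [set rnorm (x - y) | x in A & y in A].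

Lemma diam_lub A d : A !=set0 -> diam_le A d -> diam A <= d.
Proof.
move=> [a Aa] Ad; apply: ge_sup.
  by exists (rnorm (a - a)); exists a => //; exists a.
by move=> _ [x Ax [y Ay <-]]; exact: Ad.
Qed.

Lemma diam_ub A d : diam_le A d -> diam_le A (diam A).
Proof.
move=> Ad x y Ax Ay; apply: ub_le_sup; last by exists x => //; exists y.
by exists d => _ [x' Ax' [y' Ay' <-]]; exact: Ad.
Qed.

Lemma Bfam_diam A : Bfam A -> diam_le A (diam A).
Proof. by move=> [_ /bounded_diam_le[d]]; exact: diam_ub. Qed.

Lemma diam_ge0 A : Bfam A -> 0 <= diam A.
Proof.
move=> BA; have [[a Aa] _] := BA.
exact: le_trans (rnorm_ge0 (a - a)) (Bfam_diam BA Aa Aa).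
Qed.

Lemma diam_hull A : Bfam A -> diam (hull A) = diam A.
Proof.
move=> BA; have [[a Aa] _] := BA; have hd := diam_le_hull (Bfam_diam BA).
apply/le_anti/andP; split.
  by apply: diam_lub hd; exists a; exact: sub_hull.
apply: diam_lub; first by exists a.
by move=> x y Ax Ay; apply: (diam_ub hd); exact: sub_hull.
Qed.

Lemma diam_combination t A B : Bfam A -> Bfam B -> 0 <= t <= 1 ->
  diam (combination t A B) <= t * diam A + (1 - t) * diam B.
Proof.
move=> BA BB t01; have [[a Aa] _] := BA; have [[b Bb] _] := BB.
apply: diam_lub; first by exists (mix t a b); apply/combinationP; exists a, b.
move=> _ _ /combinationP[x [y [Ax By ->]]] /combinationP[x' [y' [Ax' By' ->]]].
rewrite mixB (le_trans (rnorm_mix _ _ t01))//; move: t01 => /andP[t0 t1].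
by rewrite lerD// ler_wpM2l ?subr_ge0//; exact: Bfam_diam.
Qed.

(** * Distance from the origin to the convex hull *)

Definition origin_dist A : R := inf [set rnorm x | x in hull A].

Lemma origin_dist_lb A x : hull A x -> origin_dist A <= rnorm x.
Proof.
move=> hx; apply: ge_inf; last by exists x.
by exists 0 => _ [y _ <-]; exact: rnorm_ge0.
Qed.

Lemma origin_dist_glb A d : A !=set0 ->
  (forall x, hull A x -> d <= rnorm x) -> d <= origin_dist A.
Proof.
move=> [a Aa] dA; apply: lb_le_inf.
  by exists (rnorm a); exists a => //; exact: sub_hull.
by move=> _ [x hx <-]; exact: dA.
Qed.

Lemma origin_dist_ge0 A : A !=set0 -> 0 <= origin_dist A.
Proof. by move=> A0; apply: origin_dist_glb => // x _; exact: rnorm_ge0. Qed.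

Lemma origin_dist_approx A e : A !=set0 -> 0 < e ->
  exists2 x, hull A x & rnorm x < origin_dist A + e.
Proof.
move=> [a Aa] e0.
have [|_ [x hx <-] xe] := @inf_adherent _ [set rnorm x | x in hull A] _ e0.
  split; first by exists (rnorm a); exists a => //; exact: sub_hull.
  by exists 0 => _ [y _ <-]; exact: rnorm_ge0.
by exists x.
Qed.

Lemma origin_dist_combination t A B : A !=set0 -> B !=set0 -> 0 <= t <= 1 ->
  origin_dist (combination t A B) <=
  t * origin_dist A + (1 - t) * origin_dist B.
Proof.
move=> A0 B0 t01; apply/ler_addgt0Pr => e e0.
have [x hx xe] := origin_dist_approx A0 e0.
have [y hy ye] := origin_dist_approx B0 e0.
have hxy := @hull_combination t _ _ _ _ hx hy.
apply: (le_trans (origin_dist_lb hxy)).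
apply: le_trans (rnorm_mix _ _ t01) _; move: t01 => /andP[t0 t1].
have -> : t * origin_dist A + (1 - t) * origin_dist B + e =
    t * (origin_dist A + e) + (1 - t) * (origin_dist B + e).
  by rewrite !mulrDr addrACA -mulrDl addrC (addrC t) subrK mul1r addrC.
by rewrite lerD// ler_wpM2l ?subr_ge0// ltW.
Qed.

(** * The set function and its axioms *)

Definition nu A : R := diam A + 2 * origin_dist A.

Lemma diam_le_nu A : A !=set0 -> diam A <= nu A.
Proof. by move=> A0; rewrite lerDl mulr_ge0// origin_dist_ge0. Qed.

Lemma Bfam_norm_le A x :
  A !=set0 -> (forall y, A y -> `|y| <= `|x|) -> Bfam A.
Proof.
move=> A0 Ax; split=> //; exists `|x|.
split=> [|M xM y Ay]; first exact: normr_real.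
exact: le_trans (Ax y Ay) (ltW xM).
Qed.

Lemma Bfam_set1 x : Bfam [set x].
Proof. by apply: (@Bfam_norm_le _ x) => [|_ ->//]; exists x. Qed.

Lemma nu_nonneg : nonneg_on_Bfam nu.
Proof.
by move=> A BA; rewrite (le_trans (diam_ge0 BA))// diam_le_nu //; case: BA.
Qed.

Lemma hull_set1 x : hull [set x] = [set x].
Proof.
by apply: smallest_id; apply/convex_setP => t _ _ _ -> ->; exact: mixxx.
Qed.

Lemma nu_set1 x : nu [set x] = 2 * rnorm x.
Proof.
rewrite /nu /origin_dist hull_set1 image_set1 inf1.
suff -> : diam [set x] = 0 by rewrite add0r.
apply/le_anti; rewrite diam_ge0 ?andbT//; last exact: Bfam_set1.
by apply: diam_lub => [|_ _ -> ->]; [exists x | rewrite subrr rnorm0].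
Qed.

Lemma nu_A1 : axiomA1 nu.
Proof.
split.
  exists [set 0]; split; first exact: Bfam_set1.
  by rewrite nu_set1 rnorm0 mulr0.
move=> A [BA nuA]; split=> //; have [[a Aa] _] := BA.
have diamA : diam A <= 0 by rewrite -nuA diam_le_nu//; exists a.
have -> : A = [set a].
  apply/seteqP; split=> [x Ax|_ ->//].
  apply/subr0_eq/rnorm_eq0/le_anti; rewrite rnorm_ge0 andbT.
  exact: le_trans (Bfam_diam BA Ax Aa) diamA.
rewrite -(closure_id _).1; first exact: compact_set1.
exact/accessible_closed_set1/hausdorff_accessible/norm_hausdorff.
Qed.

Lemma nu_A3 : axiomA3 nu.
Proof. by move=> A BA; rewrite /nu /origin_dist diam_hull// hull_hull. Qed.

Lemma nu_A4 : axiomA4 inK nu.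
Proof.
move=> A B t BA BB t01; have [A0 _] := BA; have [B0 _] := BB.
rewrite /nu !mulrDr addrACA lerD ?diam_combination//.
by rewrite !(mulrCA _ 2) -mulrDr ler_wpM2l// origin_dist_combination.
Qed.

(** Cantor's intersection theorem: points a n of A n form a Cauchy sequence as
    the diameters tend to 0, and its limit lies in every closed A n. *)
Lemma nu_A5 : axiomA5 nu.
Proof.
move=> A BclA decA nuA.
have A0 n : A n !=set0 by have [[]] := BclA n.
have subA n m : (n <= m)%N -> A m `<=` A n.
  elim: m => [|m IH]; first by rewrite leqn0 => /eqP->.
  rewrite leq_eqVlt => /predU1P[->//|]; rewrite ltnS => /IH Amn.
  exact: subset_trans (decA m) Amn.
have [a Aa] : {a : nat -> E & forall n, A n (a n)} := choice A0.
have a_cvg : cvg (a n @[n --> \oo]).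
  apply/cauchy_cvgP/cauchyP => e e0.
  have eE := reK (ltW e0).
  have re0 : 0 < re e by rewrite -(leW_mono ler_inK) rmorph0 eE.
  have /cvgrPdist_lt/(_ _ re0)[n _ nuAn] := nuA.
  exists (a n), n => // m /= nm; rewrite -ball_normE /=.
  rewrite -inK_rnorm -eE (leW_mono ler_inK).
  have /= := nuAn n (leqnn n); rewrite sub0r normrN; apply: le_lt_trans.
  apply: le_trans (ler_norm _); apply: le_trans (diam_le_nu (A0 n)).
  by apply: Bfam_diam (BclA n).1 _ _ _ _; [|exact: subA (Aa m)].
exists (lim (a n @[n --> \oo])) => n _.
apply: (closed_cvg _ (BclA n).2 _ _ a_cvg).
by exists n => // m nm; exact: subA (Aa m).
Qed.

(** Monotonicity would give 2 |x| = nu {x} <= nu {0, x} <= |x| for each x. *)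
Lemma nu_notA2 : [set: E] <> [set 0] -> ~ axiomA2 nu.
Proof.
move=> E0 mono; apply: E0; apply/seteqP; split=> // x _ /=.
apply: rnorm_eq0; apply/le_anti; rewrite rnorm_ge0 andbT.
have B0x : Bfam [set 0; x].
  apply: (@Bfam_norm_le _ x) => [|_ [] ->]; rewrite ?normr0//.
  by exists 0; left.
have nu0x : nu [set 0; x] <= rnorm x.
  rewrite -[leRHS]addr0 lerD//.
    apply: diam_lub; first by exists 0; left.
    move=> _ _ [] -> [] ->;
      by rewrite ?(rnormB 0) ?subrr ?subr0 ?rnorm0 ?rnorm_ge0.
  rewrite pmulr_rle0// -rnorm0; apply: origin_dist_lb.
  by apply: sub_hull; left.
have := mono _ _ (Bfam_set1 x) B0x (@subsetUr _ _ _).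
by move=> /le_trans/(_ nu0x); rewrite nu_set1 mulr2n mulrDl mul1r gerDl.
Qed.

Lemma nonmonotone_measure : [set: E] <> [set 0] ->
  exists nu : set E -> R,
    nonneg_on_Bfam nu /\ axiomA1 nu /\ axiomA3 nu /\
    axiomA4 inK nu /\ axiomA5 nu /\ ~ axiomA2 nu.
Proof.
move=> E0; exists nu; split; first exact: nu_nonneg.
split; first exact: nu_A1.
split; first exact: nu_A3.
split; first exact: nu_A4.
by split; [exact: nu_A5|exact: nu_notA2].
Qed.

End NonMonotoneMeasure.

Theorem mainTheorem2 (R : realType) :
  (forall E : completeNormedModType R,
     [set: E] <> [set 0] ->
     exists nu : set E -> R,
       nonneg_on_Bfam nu /\ axiomA1 nu /\ axiomA3 nu /\
       axiomA4 (@idfun R) nu /\ axiomA5 nu /\ ~ axiomA2 nu) /\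
  (forall E : completeNormedModType R[i],
     [set: E] <> [set 0] ->
     exists nu : set E -> R,
       nonneg_on_Bfam nu /\ axiomA1 nu /\ axiomA3 nu /\
       axiomA4 (@real_complex R) nu /\ axiomA5 nu /\ ~ axiomA2 nu).
Proof.
split=> E; first exact: (@nonmonotone_measure R R idfun idfun).
apply: (@nonmonotone_measure R R[i] (real_complex R) (@complex.Re R)).
- exact: lecR.
- by move=> k k0; exact: RRe_real (ger0_real k0).
Qed.
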